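(* For every $r\in(0,1)$, writing $r'=\sqrt{1-r^2}$, the function $\psi$ satisfies the identities $$\psi(r^2)\,\psi\left(\left(\frac{1-r}{1+r}\right)^2\right)=1,\qquad \psi\left(\frac{1-r}{1+r}\right)\psi\left(\frac{1-r'}{1+r'}\right)=1.$$
   Context: For $0<r<1$ let $\mathcal{K}(r)=\int_0^{\pi/2}\frac{dt}{\sqrt{1-r^2\sin^2t}}$ and $\mathcal{E}(r)=\int_0^{\pi/2}\sqrt{1-r^2\sin^2t}\,dt$ be the complete elliptic integrals of the first and second kind (argument is the modulus $r$). Put $r'=\sqrt{1-r^2}$, $\mathcal{K}'(r)=\mathcal{K}(r')$, $\mathcal{E}'(r)=\mathcal{E}(r')$ (the prime on $\mathcal{K},\mathcal{E}$ is not a derivative). The function $\psi:(0,1)\to(0,\infty)$ is defined by $$\psi(r)=\frac{2(\mathcal{E}(r)-(1-r)\mathcal{K}(r))}{\mathcal{E}'(r)-r\mathcal{K}'(r)}.$$ *)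

(* Defs.v *)
From Stdlib Require Import Reals.
From Coquelicot Require Import Coquelicot.
Open Scope R_scope.

(* The argument is the modulus [r], not the parameter [m = r^2].  These are
   total functions; they are only intended for [0 < r < 1], where both
   integrands are continuous on [0, PI/2]. *)
Definition ellK (r : R) : R :=
  RInt (fun t => 1 / sqrt (1 - r ^ 2 * sin t ^ 2)) 0 (PI / 2).

Definition ellE (r : R) : R :=
  RInt (fun t => sqrt (1 - r ^ 2 * sin t ^ 2)) 0 (PI / 2).

Definition compl_mod (r : R) : R := sqrt (1 - r ^ 2).

Definition ellK' (r : R) : R := ellK (compl_mod r).

Definition ellE' (r : R) : R := ellE (compl_mod r).

Definition psi (r : R) : R :=
  2 * (ellE r - (1 - r) * ellK r) / (ellE' r - r * ellK' r).

(* Main.v *)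
(** Landen's ascending transformation: the substitution
    [2 phi1 = phi + asin (k sin phi)] maps [0, PI] onto [0, PI/2] and gives, for
    [l = 2 sqrt k / (1 + k)], [K l = (1 + k) K k] and
    [E l = (2 E k - (1 - k^2) K k) / (1 + k)].
    Reading these at [s = (1 - r) / (1 + r)] (whose transform is [r']) and at
    [r] (whose transform is [s']) turns [psi s] into
    [(E' - r^2 K') / (E - r'^2 K)], which is inverted by [r <-> r'].
    This is the second identity; the first one is the second one taken at the
    modulus [(1 - r^2) / (1 + r^2)], whose complement is [2 r / (1 + r^2)]. *)

Require Import Defs.
From Stdlib Require Import Reals Lra Psatz.
From Coquelicot Require Import Coquelicot.
Open Scope R_scope.

(** * Legendre's Delta function and its integrals *)

Definition ellD (k t : R) : R := sqrt (1 - k ^ 2 * sin t ^ 2).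

Lemma sin_sq_bounds (t : R) : 0 <= sin t ^ 2 <= 1.
Proof. pose proof (sin2_cos2 t). unfold Rsqr in *. nra. Qed.

Lemma ellD_radicand_pos (k t : R) : k ^ 2 < 1 -> 0 < 1 - k ^ 2 * sin t ^ 2.
Proof. intros Hk. pose proof (sin_sq_bounds t). nra. Qed.

Lemma ellD_pos (k t : R) : k ^ 2 < 1 -> 0 < ellD k t.
Proof. intros Hk. now apply sqrt_lt_R0, ellD_radicand_pos. Qed.

Lemma ellD_sqr (k t : R) : k ^ 2 < 1 -> ellD k t ^ 2 = 1 - k ^ 2 * sin t ^ 2.
Proof. intros Hk. apply pow2_sqrt, Rlt_le, ellD_radicand_pos, Hk. Qed.

Lemma continuous_ellD (k t : R) : k ^ 2 < 1 -> continuous (ellD k) t.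
Proof.
  intros Hk. apply (ex_derive_continuous (ellD k)). unfold ellD. auto_derive.
  pose proof (ellD_radicand_pos k t Hk). simpl in *. lra.
Qed.

Lemma continuous_inv_ellD (k t : R) :
  k ^ 2 < 1 -> continuous (fun t => 1 / ellD k t) t.
Proof.
  intros Hk. apply continuous_ext with (fun t => / ellD k t).
  - intros x. unfold Rdiv. now rewrite Rmult_1_l.
  - apply continuous_Rinv_comp.
    + now apply continuous_ellD.
    + now apply Rgt_not_eq, ellD_pos.
Qed.

Lemma is_RInt_ellE (k : R) : k ^ 2 < 1 -> is_RInt (ellD k) 0 (PI / 2) (ellE k).
Proof.
  intros Hk. apply (RInt_correct (ellD k)), (ex_RInt_continuous (ellD k)).
  intros z _. now apply continuous_ellD.
Qed.

Lemma is_RInt_ellK (k : R) :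
  k ^ 2 < 1 -> is_RInt (fun t => 1 / ellD k t) 0 (PI / 2) (ellK k).
Proof.
  intros Hk. apply (RInt_correct (fun t => 1 / ellD k t)).
  apply (ex_RInt_continuous (fun t => 1 / ellD k t)).
  intros z _. now apply continuous_inv_ellD.
Qed.

(** Both halves of [[0, PI]] contribute equally. This doubling is needed because Landen's
    substitution has [[0, PI]] as its source. *)
Lemma is_RInt_reflect_PI (f : R -> R) (l : R) :
  (forall t, f (PI - t) = f t) ->
  is_RInt f 0 (PI / 2) l -> is_RInt f 0 PI (2 * l).
Proof.
  intros Hsym Hf.
  replace (2 * l) with (plus l l) by (unfold plus; simpl; ring).
  apply (is_RInt_Chasles f 0 (PI / 2) PI l l Hf).
  (* The reflection runs from [PI] down to [PI / 2] with Jacobian [-1]; reversing the bounds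
     supplies the second sign. *)
  replace l with (opp (opp l)) by (unfold opp; simpl; ring).
  apply (is_RInt_swap f).
  assert (H : is_RInt (fun y => scal (-1) (f (-1 * y + PI))) PI (PI / 2) l).
  { apply (is_RInt_comp_lin f).
    replace (-1 * PI + PI) with 0 by ring.
    now replace (-1 * (PI / 2) + PI) with (PI / 2) by field. }
  apply is_RInt_opp in H. revert H. apply is_RInt_ext. intros x _.
  replace (-1 * x + PI) with (PI - x) by ring. rewrite Hsym.
  unfold opp, scal; simpl; unfold mult; simpl; ring.
Qed.

Lemma ellD_reflect_PI (k t : R) : ellD k (PI - t) = ellD k t.
Proof. unfold ellD. now rewrite sin_PI_x. Qed.

(** * Landen's ascending transformation *)

Section Landen.

Variables k l : R.
Hypothesis Hk : 0 < k < 1.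
Hypothesis Hl : l ^ 2 = 4 * k / (1 + k) ^ 2.

Let k_sq_lt1 : k ^ 2 < 1.
Proof. nra. Qed.

Let l_sq_lt1 : l ^ 2 < 1.
Proof.
  rewrite Hl. apply Rmult_lt_reg_r with ((1 + k) ^ 2); [nra |].
  field_simplify; nra.
Qed.

Definition landen (t : R) : R := (t + asin (k * sin t)) / 2.

(** The derivative is put over one denominator so that its numerator is the one appearing in
    [ellD_landen]. *)
Definition landen' (t : R) : R := (ellD k t + k * cos t) / (2 * ellD k t).

Lemma k_sin_bounds (t : R) : -1 < k * sin t < 1.
Proof. pose proof (SIN_bound t). nra. Qed.

Lemma is_derive_landen (t : R) : is_derive landen t (landen' t).
Proof.
  pose proof (k_sin_bounds t) as Hb.
  assert (Hasin : is_derive asin (k * sin t) (1 / ellD k t)).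
  { apply is_derive_Reals.
    replace (ellD k t) with (sqrt (1 - (k * sin t)²)).
    - rewrite <- (derive_pt_asin _ Hb). exact (proj2_sig (derivable_pt_asin _ Hb)).
    - unfold ellD, Rsqr. f_equal. ring. }
  assert (Hks : is_derive (fun t => k * sin t) t (k * cos t))
    by (auto_derive; [trivial | ring]).
  pose proof (is_derive_comp asin (fun t => k * sin t) t _ _ Hasin Hks) as Hc.
  pose proof (is_derive_plus (fun t => t) _ t _ _ (is_derive_id t) Hc) as Hp.
  pose proof (is_derive_scal _ t (/ 2) _ Hp) as Hs.
  pose proof (ellD_pos k t k_sq_lt1) as HD.
  replace (landen' t)
    with (/ 2 * plus one (scal (k * cos t) (1 / ellD k t))).
  - revert Hs. apply is_derive_ext. intros x. unfold landen, plus. simpl.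
    unfold Rdiv. ring.
  - unfold landen', plus, one, scal, mult. simpl. unfold mult. simpl. field. lra.
Qed.

Lemma continuous_landen' (t : R) : continuous landen' t.
Proof.
  pose proof (ellD_pos k t k_sq_lt1) as HD.
  pose proof (ellD_radicand_pos k t k_sq_lt1) as Hr.
  apply (ex_derive_continuous landen'). unfold landen', ellD in *. auto_derive.
  unfold Rminus in *. simpl in *. repeat (split; [lra |]). exact I.
Qed.

(** The squares of the two terms differ by [1 - k ^ 2 > 0], so [ellD k t] dominates even where the
    cosine is negative. This fixes the sign of the square root in [ellD_landen]. *)
Lemma ellD_add_pos (t : R) : 0 < ellD k t + k * cos t.
Proof.
  pose proof (ellD_pos k t k_sq_lt1). pose proof (ellD_sqr k t k_sq_lt1).
  pose proof (sin2_cos2 t). unfold Rsqr in *.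
  destruct (Rle_dec 0 (k * cos t)); [lra |].
  assert ((k * cos t) ^ 2 < ellD k t ^ 2) by nra. nra.
Qed.

(** The addition formula gives [cos (2 * landen t)], hence [sin (landen t) ^ 2]; for this [l] the
    radicand is then a perfect square. *)
Lemma ellD_landen (t : R) :
  ellD l (landen t) = (ellD k t + k * cos t) / (1 + k).
Proof.
  pose proof (k_sin_bounds t) as Hb.
  pose proof (ellD_add_pos t) as Hpos.
  pose proof (ellD_sqr k t k_sq_lt1) as HD.
  pose proof (sin2_cos2 t) as Hsc. unfold Rsqr in Hsc.
  assert (Hcos : cos (2 * landen t) = cos t * ellD k t - k * sin t ^ 2).
  { unfold landen.
    replace (2 * ((t + asin (k * sin t)) / 2)) with (t + asin (k * sin t)) by field.
    rewrite cos_plus, sin_asin, cos_asin by lra.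
    replace (sqrt (1 - (k * sin t)²)) with (ellD k t).
    - ring.
    - unfold ellD, Rsqr. f_equal. ring. }
  rewrite cos_2a_sin in Hcos.
  rewrite <- (sqrt_pow2 ((ellD k t + k * cos t) / (1 + k)))
    by (apply Rlt_le, Rdiv_lt_0_compat; lra).
  unfold ellD at 1. f_equal.
  replace (sin (landen t) ^ 2)
    with ((1 - (cos t * ellD k t - k * sin t ^ 2)) / 2) by nra.
  rewrite Hl.
  replace (((ellD k t + k * cos t) / (1 + k)) ^ 2)
    with ((ellD k t ^ 2 + 2 * k * cos t * ellD k t + k ^ 2 * cos t ^ 2) / (1 + k) ^ 2)
    by (field; lra).
  rewrite HD. replace (cos t ^ 2) with (1 - sin t ^ 2) by nra. field. lra.
Qed.

Lemma RInt_landen (f : R -> R) :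
  (forall t, continuous f t) ->
  RInt (fun t => landen' t * f (landen t)) 0 PI = RInt f 0 (PI / 2).
Proof.
  intros Hf.
  replace (RInt f 0 (PI / 2)) with (RInt f (landen 0) (landen PI)).
  - apply (RInt_comp f landen landen').
    + intros; apply Hf.
    + intros; split; [apply is_derive_landen | apply continuous_landen'].
  - f_equal; unfold landen; rewrite ?sin_0, ?sin_PI, Rmult_0_r, asin_0; field.
Qed.

Lemma is_RInt_ellK_PI : is_RInt (fun t => 1 / ellD k t) 0 PI (2 * ellK k).
Proof.
  apply is_RInt_reflect_PI; [| now apply is_RInt_ellK].
  intros; now rewrite ellD_reflect_PI.
Qed.

Lemma is_RInt_ellE_PI : is_RInt (ellD k) 0 PI (2 * ellE k).
Proof.
  apply is_RInt_reflect_PI; [| now apply is_RInt_ellE].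
  intros; now rewrite ellD_reflect_PI.
Qed.

(** The factor [ellD k t + k * cos t] cancels between [landen'] and [ellD l (landen t)], leaving a
    constant multiple of [1 / ellD k t]. *)
Lemma ellK_landen : ellK l = (1 + k) * ellK k.
Proof.
  change (RInt (fun t => 1 / ellD l t) 0 (PI / 2) = (1 + k) * ellK k).
  rewrite <- RInt_landen by (intros; now apply continuous_inv_ellD).
  apply is_RInt_unique.
  replace ((1 + k) * ellK k) with (scal ((1 + k) / 2) (2 * ellK k))
    by (unfold scal; simpl; unfold mult; simpl; field).
  apply (is_RInt_ext (fun t => scal ((1 + k) / 2) (1 / ellD k t))).
  - intros t _. rewrite ellD_landen. unfold landen', scal; simpl; unfold mult; simpl.
    pose proof (ellD_add_pos t). pose proof (ellD_pos k t k_sq_lt1).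
    field. repeat split; lra.
  - apply (is_RInt_scal (fun t => 1 / ellD k t)), is_RInt_ellK_PI.
Qed.

Lemma is_RInt_cos_0_PI : is_RInt cos 0 PI 0.
Proof.
  replace 0 with (minus (sin PI) (sin 0)) at 2
    by (rewrite sin_PI, sin_0; unfold minus, plus, opp; simpl; ring).
  apply (is_RInt_derive sin cos); intros x _.
  - apply is_derive_sin.
  - apply continuous_cos.
Qed.

(** Here the factor is squared. Expanding splits the integrand into multiples of [ellD k t],
    [1 / ellD k t] and [cos t], the last of which integrates to 0. *)
Lemma ellE_landen : ellE l = (2 * ellE k - (1 - k ^ 2) * ellK k) / (1 + k).
Proof.
  change (RInt (ellD l) 0 (PI / 2) = (2 * ellE k - (1 - k ^ 2) * ellK k) / (1 + k)).
  rewrite <- RInt_landen by (intros; now apply continuous_ellD).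
  apply is_RInt_unique.
  pose proof (is_RInt_scal _ _ _ (1 / (1 + k)) _ is_RInt_ellE_PI) as HE.
  pose proof (is_RInt_scal _ _ _ ((1 - k ^ 2) / (2 * (1 + k))) _ is_RInt_ellK_PI) as HK.
  pose proof (is_RInt_scal _ _ _ (k / (1 + k)) _ is_RInt_cos_0_PI) as HC.
  pose proof (is_RInt_plus _ _ _ _ _ _ (is_RInt_minus _ _ _ _ _ _ HE HK) HC) as H.
  unfold minus, plus, opp, scal, mult in H. simpl in H. unfold mult in H. simpl in H.
  replace ((2 * ellE k - (1 - k ^ 2) * ellK k) / (1 + k))
    with (1 / (1 + k) * (2 * ellE k)
          + - ((1 - k * (k * 1)) / (2 * (1 + k)) * (2 * ellK k)) + k / (1 + k) * 0)
    by (field; lra).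
  revert H. apply is_RInt_ext. intros t _. rewrite ellD_landen. unfold landen'.
  pose proof (ellD_pos k t k_sq_lt1). pose proof (ellD_sqr k t k_sq_lt1) as HD.
  pose proof (sin2_cos2 t) as Hsc. unfold Rsqr in Hsc.
  replace (1 - k * (k * 1)) with (ellD k t ^ 2 - k ^ 2 * cos t ^ 2)
    by (rewrite HD; replace (cos t ^ 2) with (1 - sin t ^ 2) by nra; ring).
  change (NormedModule.sort R_AbsRing R_NormedModule) with R. field. split; lra.
Qed.

End Landen.

(** * Nonvanishing denominators and complementary moduli *)

(** The combined integrand is [k ^ 2 * cos t ^ 2 / ellD k t], positive inside the interval. *)
Lemma ellE_sub_ellK_pos (k : R) :
  0 < k < 1 -> 0 < ellE k - (1 - k ^ 2) * ellK k.
Proof.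
  intros Hk. assert (Hk2 : k ^ 2 < 1) by nra.
  replace (ellE k - (1 - k ^ 2) * ellK k)
    with (RInt (fun t => ellD k t - (1 - k ^ 2) * (1 / ellD k t)) 0 (PI / 2)).
  2: { apply is_RInt_unique.
       apply (is_RInt_minus (ellD k) (fun t => (1 - k ^ 2) * (1 / ellD k t))).
       - now apply is_RInt_ellE.
       - now apply (is_RInt_scal (fun t => 1 / ellD k t)), is_RInt_ellK. }
  apply RInt_gt_0.
  - pose proof PI_RGT_0. lra.
  - intros t Ht.
    pose proof (ellD_pos k t Hk2) as HD. pose proof (ellD_sqr k t Hk2) as HD2.
    assert (Hc : 0 < cos t) by (apply cos_gt_0; lra).
    pose proof (sin2_cos2 t) as Hsc. unfold Rsqr in Hsc.
    replace (1 - k ^ 2) with (ellD k t ^ 2 - k ^ 2 * cos t ^ 2)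
      by (rewrite HD2; replace (cos t ^ 2) with (1 - sin t ^ 2) by nra; ring).
    replace (ellD k t - _) with (k ^ 2 * cos t ^ 2 / ellD k t) by (field; lra).
    apply Rdiv_lt_0_compat; [| exact HD]. apply Rmult_lt_0_compat; nra.
  - intros t _.
    apply (continuous_minus (ellD k) (fun t => (1 - k ^ 2) * (1 / ellD k t))).
    + now apply continuous_ellD.
    + apply (continuous_scal_r (1 - k ^ 2) (fun t => 1 / ellD k t)).
      now apply continuous_inv_ellD.
Qed.

Lemma compl_mod_bounds (r : R) : 0 < r < 1 -> 0 < compl_mod r < 1.
Proof.
  intros Hr. unfold compl_mod. split.
  - apply sqrt_lt_R0. nra.
  - rewrite <- sqrt_1 at 2. apply sqrt_lt_1; nra.
Qed.

Lemma compl_mod_sqr (r : R) : 0 < r < 1 -> compl_mod r ^ 2 = 1 - r ^ 2.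
Proof. intros Hr. apply pow2_sqrt. nra. Qed.

Lemma compl_mod_eq (r q : R) : 0 <= q -> q ^ 2 + r ^ 2 = 1 -> compl_mod r = q.
Proof.
  intros Hq H. unfold compl_mod. replace (1 - r ^ 2) with (q ^ 2) by lra.
  now apply sqrt_pow2.
Qed.

(** * The functional equations of [psi] *)

Lemma psi_landen (r : R) : 0 < r < 1 ->
  psi ((1 - r) / (1 + r)) =
  (ellE' r - r ^ 2 * ellK' r) / (ellE r - (1 - r ^ 2) * ellK r).
Proof.
  intros Hr. set (s := (1 - r) / (1 + r)).
  assert (Hs : 0 < s < 1).
  { split; unfold s.
    - apply Rdiv_lt_0_compat; lra.
    - apply Rmult_lt_reg_r with (1 + r); [lra |]. field_simplify; lra. }
  (* The involution [x -> (1 - x) / (1 + x)] exchanges [r] and [s], so the complement of each is the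
     Landen transform of the other. *)
  assert (HE : (compl_mod r) ^ 2 = 4 * s / (1 + s) ^ 2).
  { rewrite compl_mod_sqr by exact Hr. unfold s. field. split; lra. }
  assert (HF : (compl_mod s) ^ 2 = 4 * r / (1 + r) ^ 2).
  { rewrite compl_mod_sqr by exact Hs. unfold s. field. lra. }
  pose proof (ellE_sub_ellK_pos r Hr) as Hpos.
  unfold psi, ellE', ellK'.
  rewrite (ellE_landen s (compl_mod r) Hs HE), (ellK_landen s (compl_mod r) Hs HE).
  rewrite (ellE_landen r (compl_mod s) Hr HF), (ellK_landen r (compl_mod s) Hr HF).
  (* The denominator of [psi s] becomes a multiple of the quantity in [Hpos], so it is nonzero. *)
  replace ((2 * ellE r - (1 - r ^ 2) * ellK r) / (1 + r) - s * ((1 + r) * ellK r))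
    with (2 * (ellE r - (1 - r ^ 2) * ellK r) / (1 + r))
    by (unfold s; field; lra).
  unfold s. field. repeat split; lra.
Qed.

Lemma psi_landen_mul_compl (r : R) : 0 < r < 1 ->
  psi ((1 - r) / (1 + r)) * psi ((1 - compl_mod r) / (1 + compl_mod r)) = 1.
Proof.
  intros Hr. pose proof (compl_mod_bounds r Hr) as Hc.
  pose proof (compl_mod_sqr r Hr) as Hc2.
  rewrite (psi_landen r Hr), (psi_landen (compl_mod r) Hc).
  pose proof (ellE_sub_ellK_pos r Hr) as H1.
  pose proof (ellE_sub_ellK_pos (compl_mod r) Hc) as H2.
  unfold ellE', ellK'.
  (* Complementation is an involution, so the second quotient is the first one inverted. *)
  rewrite (compl_mod_eq (compl_mod r) r) by lra.
  rewrite Hc2 in *. replace (1 - (1 - r ^ 2)) with (r ^ 2) in * by ring.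
  field. split; lra.
Qed.

Theorem theorem1p7 :
  forall r : R, 0 < r < 1 ->
    psi (r ^ 2) * psi (((1 - r) / (1 + r)) ^ 2) = 1 /\
    psi ((1 - r) / (1 + r)) *
      psi ((1 - compl_mod r) / (1 + compl_mod r)) = 1.
Proof.
  intros r Hr. split; [| now apply psi_landen_mul_compl].
  (* By the same involution [u] is sent back to [r ^ 2], while its complement is sent to
     [((1 - r) / (1 + r)) ^ 2]. *)
  set (u := (1 - r ^ 2) / (1 + r ^ 2)).
  assert (Hu : 0 < u < 1).
  { split; unfold u.
    - apply Rdiv_lt_0_compat; nra.
    - apply Rmult_lt_reg_r with (1 + r ^ 2); [nra |]. field_simplify; nra. }
  assert (Hu' : compl_mod u = 2 * r / (1 + r ^ 2)).
  { apply compl_mod_eq.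
    - apply Rlt_le, Rdiv_lt_0_compat; nra.
    - unfold u. field. nra. }
  pose proof (psi_landen_mul_compl u Hu) as H. rewrite Hu' in H.
  replace ((1 - u) / (1 + u)) with (r ^ 2) in H by (unfold u; field; nra).
  replace ((1 - 2 * r / (1 + r ^ 2)) / (1 + 2 * r / (1 + r ^ 2)))
    with (((1 - r) / (1 + r)) ^ 2) in H by (field; repeat split; nra).
  exact H.
Qed.
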